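(* Let $S$ be a finite poset, let $\mathcal{C}=\{C_1,\dots,C_k\}$ be a chain decomposition of $S$ into $k$ chains, and color $S$ by assigning color $i$ to every element of $C_i$. Then for any chain decomposition $\mathcal{C}'$ of $S$, there exists a finite (possibly empty) sequence of legal merges, with respect to this coloring, starting from $\mathcal{C}'$ and resulting in a chain decomposition $\mathcal{C}''$ of $S$ in which the minimal elements of the chains have pairwise distinct colors.
   Context: A chain decomposition of a finite poset $S$ is a partition of $S$ into nonempty chains (totally ordered subsets). Given the chain decomposition $\mathcal{C}=\{C_1,\dots,C_k\}$, the coloring scheme assigns color $i$ to each $x\in C_i$; thus two elements share a color if and only if they belong to the same chain of $\mathcal{C}$, so any two elements of the same color are comparable. For a chain $A$ in an arbitrary chain decomposition of $S$, its monochromatic bottom segment $\mathrm{bot}(A)$ is the largest initial segment (in the order of $A$, starting from $\min A$) all of whose elements have the color of $\min A$. Legal merge (with respect to the coloring): let $\mathcal{D}$ be a chain decomposition of $S$ and let $A\neq B$ be two chains in $\mathcal{D}$ whose minimal elements have the same color. Then $\max \mathrm{bot}(A)$ and $\max\mathrm{bot}(B)$ are distinct comparable elements; name the chains so that $\max \mathrm{bot}(A)<\max \mathrm{bot}(B)$. The legal merge replaces $B$ by $B\cup \mathrm{bot}(A)$ and $A$ by $A\setminus \mathrm{bot}(A)$, discarding the latter if it is empty, and leaves all other chains of $\mathcal{D}$ unchanged. The result is again a chain decomposition of $S$. *)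

(* Defs.v *)
From mathcomp Require Import all_boot all_order.

Set Implicit Arguments.
Unset Strict Implicit.
Unset Printing Implicit Defensive.

Local Open Scope order_scope.

Section Chains.
Context {disp : Order.disp_t} {S : finPOrderType disp}.
Implicit Types (A I : {set S}) (m : S) (D : {set {set S}}).

Definition is_chain A : Prop := {in A &, forall x y, x >=< y}.

(* [partition] already requires every block to be nonempty. *)
Definition chain_decomposition D : Prop :=
  partition D [set: S] /\ {in D, forall A, is_chain A}.

Definition is_min A m : Prop := m \in A /\ {in A, forall x, m <= x}.

Definition is_max A m : Prop := m \in A /\ {in A, forall x, x <= m}.

Definition initial_segment A I : Prop :=
  I \subset A /\ {in I & A, forall x y, y <= x -> y \in I}.

Section Coloring.
Context {K : Type} (color : S -> K).

Definition mono_initial_segment A I : Prop :=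
  initial_segment A I /\
  exists2 m, is_min A m & {in I, forall x, color x = color m}.

Definition is_bot A I : Prop :=
  mono_initial_segment A I /\
  forall J, mono_initial_segment A J -> J \subset I.

Definition merged D A B (botA : {set S}) : {set {set S}} :=
  (D :\: [set A; B]) :|: [set B :|: botA]
  :|: (if A :\: botA == set0 then set0 else [set A :\: botA]).

(* [A] and [B] play symmetric roles until [ma < mb], which selects the chain
   that loses its bottom segment. *)
Definition legal_merge D D' : Prop :=
  chain_decomposition D /\
  exists A B, [/\ A \in D, B \in D, A != B,
    exists a b, [/\ is_min A a, is_min B b & color a = color b] &
    exists botA botB ma mb,
      [/\ is_bot A botA, is_bot B botB,
          is_max botA ma /\ is_max botB mb, ma < mb &
          D' = merged D A B botA]].

Definition distinct_min_colors D : Prop :=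
  forall A B a b, A \in D -> B \in D -> A != B ->
    is_min A a -> is_min B b -> color a <> color b.

End Coloring.
End Chains.

(* Main.v *)
Require Import Defs.
From mathcomp Require Import all_boot all_order.
From Stdlib Require Import Relation_Operators.

(** Call [x] extendable in [D] if some larger element of its chain is joined to
    it by a monochromatic stretch of that chain, i.e. if [x] is not the top of a
    maximal monochromatic run.  A legal merge moves the run [bot A] below
    [max (bot B)], so it keeps every extendable element extendable and makes
    [max (bot A)] extendable.  Hence the set of extendable elements strictly
    grows and every sequence of merges terminates; it can only stop when the
    minimal elements have pairwise distinct colors. *)

Set Implicit Arguments.
Unset Strict Implicit.
Unset Printing Implicit Defensive.

Import Order.TTheory.
Local Open Scope order_scope.

Lemma partition_block_unique (T : finType) (P : {set {set T}}) (E X Y : {set T})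
    (x : T) :
  partition P E -> X \in P -> Y \in P -> x \in X -> x \in Y -> X = Y.
Proof.
move=> /partition_trivIset tP XP YP xX xY.
by rewrite -(def_pblock tP XP xX) (def_pblock tP YP xY).
Qed.

Section Merging.
Context {disp : Order.disp_t} {S : finPOrderType disp}.
Context {K : eqType} (color : S -> K).
Implicit Types (A B I J X : {set S}) (D : {set {set S}}) (x y z m : S).

(** * Minima, maxima and bottom segments *)

Lemma is_min_unique A x y : is_min A x -> is_min A y -> x = y.
Proof. by move=> [xA minx] [yA miny]; apply/le_anti; rewrite minx // miny. Qed.

Lemma chain_has_max A x : is_chain A -> x \in A -> exists m, is_max A m.
Proof.
move=> chA xA.
have [m mA mmax] := comparable_arg_maxP (F := id) xA chA.
by exists m; split.
Qed.

Lemma is_bot_exists A m : is_min A m -> exists2 I, is_bot color A I & m \in I.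
Proof.
move=> minm; have [mA mle] := minm.
(* The witness collects the [x] whose whole down-set in [A] has the color of [m]. Any monochromatic
   initial segment [J] lies in it, because [J] contains the down-set of each of its elements. *)
exists [set x in A | [forall y in A, (y <= x) ==> (color y == color m)]];
  last first.
  rewrite inE mA; apply/forall_inP => y yA; apply/implyP => ym.
  by apply/eqP; congr color; apply/le_anti; rewrite ym mle.
split.
  split; last first.
    exists m => // x; rewrite inE => /andP[xA /forall_inP/(_ _ xA)].
    by rewrite lexx => /eqP.
  split; first by apply/subsetP => x; rewrite inE => /andP[].
  move=> x y; rewrite !inE => /andP[_ /forall_inP xP] yA yx; rewrite yA.
  apply/forall_inP => z zA; apply/implyP => zy.
  exact: (implyP (xP z zA)) (le_trans zy yx).
move=> J [[JA Jini] [m' minm' Jcol]]; apply/subsetP => x xJ; rewrite inE.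
rewrite (subsetP JA) //=; apply/forall_inP => y yA; apply/implyP => yx.
by rewrite (is_min_unique minm minm') Jcol //; apply: Jini yx.
Qed.

Lemma is_bot_color A I m :
  is_bot color A I -> is_min A m -> {in I, forall x, color x = color m}.
Proof.
by move=> [[_ [m' minm' Icol]] _] minm x xI; rewrite (is_min_unique minm minm') Icol.
Qed.

(** If the color persists from [a] up to [y], then the down-set of [y] in [A] is itself a
    monochromatic initial segment, so maximality of [I] absorbs it. *)
Lemma is_bot_maximal A I m a y :
    is_chain A -> is_bot color A I -> is_min A m -> is_max I a -> y \in A ->
    {in A, forall z, a < z <= y -> color z = color m} -> y \in I.
Proof.
move=> chA botI minm [aI amax] yA ycol.
have Icol := is_bot_color botI minm; have [[[IA Iini] _] Imax] := botI.
suff JI : [set z in A | z <= y] \subset I.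
  by apply: (subsetP JI); rewrite inE yA lexx.
apply: Imax; split.
  split; first by apply/subsetP => z; rewrite inE => /andP[].
  by move=> x z; rewrite !inE => /andP[_ xy] -> zx; rewrite (le_trans zx xy).
exists m => // z; rewrite inE => /andP[zA zy].
have [za|az] := comparable_leP (chA _ _ zA (subsetP IA a aI)).
  exact/Icol/(Iini a).
by apply: ycol; rewrite ?az.
Qed.

(** * Merging preserves partitions *)

Lemma in_merged D A B I X :
  (X \in merged D A B I) =
  [|| [&& X \in D, X != A & X != B], X == B :|: I
    | (X == A :\: I) && (X != set0)].
Proof.
rewrite /merged !inE negb_or -orbA [X in [|| X, _ | _]]andbC.
congr [|| _, _ | _].
by case: ifPn => [/eqP->|nz]; rewrite inE; case: eqP => // ->; rewrite ?eqxx ?nz.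
Qed.

Lemma merged_partition D A B I (E : {set S}) :
    partition D E -> A \in D -> B \in D -> A != B -> I \subset A ->
  partition (merged D A B I) E.
Proof.
move=> pD AD BD neAB /subsetP IA; have uniqD := partition_block_unique pD.
apply/and3P; split.
- apply/eqP/setP => x; rewrite -(cover_partition pD).
  apply/bigcupP/bigcupP => [[X]|[X XD xX]].
    rewrite in_merged => /or3P[/and3P[XD _ _] xX|/eqP->|/andP[/eqP-> _]].
    + by exists X.
    + by rewrite inE => /orP[xB|/IA xA]; [exists B | exists A].
    + by rewrite inE => /andP[_ xA]; exists A.
  have [xI|xI] := boolP (x \in I).
    by exists (B :|: I); rewrite ?in_merged ?eqxx ?orbT // inE xI orbT.
  have [eXA|neXA] := eqVneq X A.
    have xAI : x \in A :\: I by rewrite inE xI -eXA.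
    exists (A :\: I); rewrite ?in_merged ?eqxx //=.
    by apply/or3P/Or33/set0Pn; exists x.
  have [eXB|neXB] := eqVneq X B.
    by exists (B :|: I); rewrite ?in_merged ?eqxx ?orbT // inE -eXB xX.
  by exists X; rewrite // in_merged XD neXA neXB.
(* Disjointness is recast as: two blocks sharing a point coincide. For blocks of different kinds,
   the shared point would lie in two distinct blocks of [D], or both inside and outside [I]. *)
- suff ovl X Y x : X \in merged D A B I -> Y \in merged D A B I ->
      x \in X -> x \in Y -> X = Y.
    apply/trivIsetP => X Y XD YD; apply: contraR => /pred0Pn[x /andP[xX xY]].
    exact/eqP/(ovl X Y x).
  have notAB : x \in A -> x \in B -> False.
    by move=> xA xB; rewrite (uniqD _ _ x AD BD) ?eqxx in neAB.
  rewrite !in_merged => /or3P[/and3P[XD XA XB]|/eqP->|/andP[/eqP-> _]]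
    /or3P[/and3P[YD YA YB]|/eqP->|/andP[/eqP-> _]] //.
  + exact: uniqD.
  + move=> xX; rewrite inE => /orP[xB|/IA xA].
      by rewrite (uniqD _ _ x XD BD) ?eqxx in XB.
    by rewrite (uniqD _ _ x XD AD) ?eqxx in XA.
  + move=> xX; rewrite inE => /andP[_ xA].
    by rewrite (uniqD _ _ x XD AD) ?eqxx in XA.
  + move=> xBI xY; move: xBI; rewrite inE => /orP[xB|/IA xA].
      by rewrite (uniqD _ _ x YD BD) ?eqxx in YB.
    by rewrite (uniqD _ _ x YD AD) ?eqxx in YA.
  + by rewrite !inE => /orP[xB /andP[_ /notAB]//|-> //].
  + move=> xAI xY; move: xAI; rewrite inE => /andP[_ xA].
    by rewrite (uniqD _ _ x YD AD) ?eqxx in YA.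
  + by rewrite !inE => /andP[/negPf-> xA]; rewrite orbF => /(notAB xA).
- apply/negP; rewrite in_merged eqxx andbF orbF.
  case/orP => [/and3P[]|]; first by rewrite (partition0 pD).
  rewrite eq_sym setU_eq0 => /andP[/eqP B0 _].
  by move: BD; rewrite B0 (partition0 pD).
Qed.

(** The witness [y] need not be the successor of [x], so it can survive the insertion of further
    elements between [x] and [y]. *)
Definition extendable D : {set S} :=
  [set x | [exists X in D, exists y in X,
     [&& x \in X, x < y &
       [forall z in X, (x < z <= y) ==> (color z == color x)]]]].

Lemma extendableP D x :
  reflect (exists X y, [/\ X \in D, x \in X, y \in X, x < y &
             {in X, forall z, x < z <= y -> color z = color x}])
          (x \in extendable D).
Proof.
rewrite inE; apply: (iffP exists_inP).
  move=> [X XD /exists_inP[y yX /and3P[xX xy /forall_inP zP]]].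
  by exists X, y; split=> // z zX xzy; apply/eqP/(implyP (zP z zX)).
move=> [X [y [XD xX yX xy zP]]]; exists X => //; apply/exists_inP.
exists y => //; rewrite xX xy; apply/forall_inP => z zX.
by apply/implyP => xzy; rewrite zP.
Qed.

(** An element of [B] below [b] lies in [J], where comparability with [I] is assumed; one above [b]
    exceeds [a], hence all of [I]. *)
Lemma merge_chain A B I J a b :
    is_chain A -> is_chain B -> I \subset A -> initial_segment B J ->
    {in I & J, forall x y, x >=< y} -> is_max I a -> is_max J b -> a < b ->
  is_chain (B :|: I).
Proof.
move=> chA chB /subsetP IA [JB Jini] compIJ [aI amax] [bJ bmax] ab.
have compIB x y : x \in I -> y \in B -> x >=< y.
  move=> xI yB.
  have [yb|by_] := comparable_leP (chB _ _ yB (subsetP JB b bJ)).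
    exact/compIJ/(Jini b).
  by apply/le_comparable/ltW/(le_lt_trans (amax x xI))/(lt_trans ab).
move=> x y; rewrite !inE => /orP[xB|xI] /orP[yB|yI].
- exact: chB.
- by rewrite comparable_sym compIB.
- exact: compIB.
- exact: chA (IA x xI) (IA y yI).
Qed.

Lemma merge_extendable D A B I J a b (c : K) :
    chain_decomposition D -> A \in D -> B \in D -> A != B ->
    initial_segment A I -> initial_segment B J ->
    {in I, forall x, color x = c} -> {in J, forall x, color x = c} ->
    is_max I a -> is_max J b -> a < b ->
  I :|: extendable D \subset extendable (merged D A B I).
Proof.
move=> [pD chD] AD BD neAB [IA Iini] [JB Jini] Icol Jcol [aI amax] [bJ bmax] ab.
have BI_in : B :|: I \in merged D A B I by rewrite in_merged eqxx orbT.
have I_ext x : x \in I -> x \in extendable (merged D A B I).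
  (* The top [b] of [J] is the witness: every element of the new block up to [b] comes from [I] or
     [J] and so has color [c]. *)
  move=> xI; apply/extendableP; exists (B :|: I), b; split=> //.
  - by rewrite inE xI orbT.
  - by rewrite inE (subsetP JB).
  - exact: le_lt_trans (amax x xI) ab.
  - move=> z; rewrite inE (Icol x xI) => /orP[zB /andP[_ zb]|zI _].
      exact/Jcol/(Jini b).
    exact: Icol.
apply/subsetP => x; rewrite inE => /orP[/I_ext//|].
have [xI _|xI] := boolP (x \in I); first exact: I_ext.
move=> /extendableP[X [y [XD xX yX xy xycol]]]; apply/extendableP.
have [eXB|neXB] := eqVneq X B.
  subst X; exists (B :|: I), y; split; rewrite // ?inE ?xX ?yX //.
  move=> z; rewrite inE => /orP[zB|zI] xzy; first exact: xycol.
  (* An element [z] of [I] inserted above [x] forces [x < z <= a < b], so [x] lies in [J] and shares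
     the color [c] of [z]. *)
  have xb : x <= b.
    have /andP[xz _] := xzy.
    by apply/ltW/(lt_trans xz)/(le_lt_trans (amax z zI)).
  by rewrite Icol // Jcol //; apply: Jini xb.
have [eXA|neXA] := eqVneq X A; last first.
  by exists X, y; split; rewrite // in_merged XD neXA neXB.
(* [I] is downward closed in [A], so the old witness above [x] survives in [A :\: I]. *)
subst X; have yI : y \notin I.
  by apply: contra xI => yI; apply: Iini (ltW xy).
have xAI : x \in A :\: I by rewrite inE xI.
exists (A :\: I), y; split=> //.
- by rewrite in_merged eqxx; apply/or3P/Or33/set0Pn; exists x.
- by rewrite inE yI.
- move=> z; rewrite inE => /andP[_ zA]; exact: xycol.
Qed.

(** * Legal merges, for a coloring whose color classes are chains *)

Context (color_comparable : forall x y, color x = color y -> x >=< y).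

Lemma legal_merge_chain_decomposition D D' :
  legal_merge color D D' -> chain_decomposition D'.
Proof.
move=> [[pD chD] [A [B [AD BD neAB [a [b [minA minB cab]]]
  [I [J [ma [mb [botI botJ [maxI maxJ] mab ->]]]]]]]]].
have [[[IA _] _] _] := botI; have [[Jseg _] _] := botJ.
split; first exact: merged_partition.
move=> X; rewrite in_merged.
case/or3P => [/and3P[/chD//]|/eqP->|/andP[/eqP-> _]].
  apply: merge_chain (chD A AD) (chD B BD) IA Jseg _ maxI maxJ mab.
  move=> x y xI yJ; apply: color_comparable.
  by rewrite (is_bot_color botI minA xI) (is_bot_color botJ minB yJ).
by move=> x y /setDP[xA _] /setDP[yA _]; apply: chD AD _ _ xA yA.
Qed.

Lemma legal_merge_extendable D D' :
  legal_merge color D D' -> extendable D \proper extendable D'.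
Proof.
move=> [Ddec [A [B [AD BD neAB [a [b [minA minB cab]]]
  [I [J [ma [mb [botI botJ [maxI maxJ] mab ->]]]]]]]]].
have [pD chD] := Ddec.
have Icol := is_bot_color botI minA; have Jcol := is_bot_color botJ minB.
rewrite -cab in Jcol.
have [[Iseg _] _] := botI; have [[Jseg _] _] := botJ.
have /subsetP sub :=
  merge_extendable Ddec AD BD neAB Iseg Jseg Icol Jcol maxI maxJ mab.
have [maI mamax] := maxI; have maA := subsetP (proj1 Iseg) ma maI.
apply/properP; split; first by apply/subsetP => x xD; rewrite sub // inE xD orbT.
exists ma; first by rewrite sub // inE maI.
(* A witness for [ma] in [D] would continue the color of the bottom segment past [ma], contradicting
   the maximality of [I]. *)
apply/negP => /extendableP[X [y [XD maX yX may ycol]]].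
have eXA := partition_block_unique pD XD AD maX maA; subst X.
rewrite (Icol ma maI) in ycol.
have /mamax := is_bot_maximal (chD A AD) botI minA maxI yX ycol.
by rewrite (lt_geF may).
Qed.

Lemma legal_merge_exists D A B a b :
    chain_decomposition D -> A \in D -> B \in D -> A != B ->
    is_min A a -> is_min B b -> color a = color b ->
  exists D', legal_merge color D D'.
Proof.
move=> Ddec AD BD neAB minA minB cab; have [pD chD] := Ddec.
have [I botI aI] := is_bot_exists minA; have [J botJ bJ] := is_bot_exists minB.
have [[[/subsetP IA _] _] _] := botI; have [[[/subsetP JB _] _] _] := botJ.
have [ma maxI] : exists m, is_max I m.
  by apply: chain_has_max aI => x y /IA xA /IA; apply: chD.
have [mb maxJ] : exists m, is_max J m.
  by apply: chain_has_max bJ => x y /JB xB /JB; apply: chD.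
have [maI _] := maxI; have [mbJ _] := maxJ.
have cmp : ma >=< mb.
  apply: color_comparable.
  by rewrite (is_bot_color botI minA maI) (is_bot_color botJ minB mbJ).
(* The strict cases decide which chain gives up its bottom segment; equality would put one element
   in both [A] and [B]. *)
case: (comparable_ltgtP cmp) => [lt_ab|lt_ba|eq_ab].
- exists (merged D A B I); split=> //; exists A, B; split=> //.
    by exists a, b.
  by exists I, J, ma, mb.
- exists (merged D B A J); split=> //; exists B, A; split; rewrite 1?eq_sym //.
    by exists b, a.
  by exists J, I, mb, ma.
- case/eqP: neAB; apply: (partition_block_unique pD AD BD (IA _ maI)).
  by rewrite eq_ab JB.
Qed.

(** A boolean form of minimality turns the search for two minima of one color into a decidable
    question over a finite type. *)
Definition is_minb A m := (m \in A) && [forall x in A, m <= x].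

Lemma is_minP A m : reflect (is_min A m) (is_minb A m).
Proof.
apply: (iffP andP) => [[mA /forall_inP mle]|[mA mle]]; split=> //.
exact/forall_inP.
Qed.

Lemma distinct_min_colors_or_merge D :
  chain_decomposition D ->
  distinct_min_colors color D \/ exists D', legal_merge color D D'.
Proof.
move=> Ddec.
have [/existsP[[[A B] [a b]] /= /and5P[AD BD neAB ma /andP[mb cab]]]|no] :=
  boolP [exists p : ({set S} * {set S}) * (S * S),
    [&& p.1.1 \in D, p.1.2 \in D, p.1.1 != p.1.2, is_minb p.1.1 p.2.1,
        is_minb p.1.2 p.2.2 & color p.2.1 == color p.2.2]].
  right; move/is_minP: ma => ma; move/is_minP: mb => mb.
  exact: legal_merge_exists Ddec AD BD neAB ma mb (eqP cab).
left=> A B a b AD BD neAB /is_minP ma /is_minP mb cab.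
case/negP: no; apply/existsP; exists ((A, B), (a, b)).
by rewrite /= AD BD neAB ma mb cab eqxx.
Qed.

Lemma merges_to_distinct_min_colors D :
  chain_decomposition D ->
  exists D', [/\ clos_refl_trans _ (legal_merge color) D D',
                 chain_decomposition D' & distinct_min_colors color D'].
Proof.
(* Strong induction on the number of non-extendable elements, which each legal merge decreases. *)
have [n] := ubnP #|~: extendable D|.
elim: n D => // n IHn D /ltnSE le_n Ddec.
have [dist|[D1 step]] := distinct_min_colors_or_merge Ddec.
  by exists D; split=> //; apply: rt_refl.
have lt_n : (#|~: extendable D1| < n)%N.
  apply: leq_trans le_n; apply: proper_card.
  by rewrite properC legal_merge_extendable.
have [D' [D1D' D'dec dist]] :=
  IHn D1 lt_n (legal_merge_chain_decomposition step).
by exists D'; split=> //; apply: rt_trans D1D'; apply: rt_step.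
Qed.

End Merging.

Theorem mainTheorem1 (disp : Order.disp_t) (S : finPOrderType disp) (k : nat)
    (C : 'I_k -> {set S}) (C_inj : injective C)
    (C_dec : chain_decomposition [set C i | i : 'I_k])
    (color : S -> 'I_k) (color_C : forall i x, x \in C i -> color x = i)
    (C' : {set {set S}}) (C'_dec : chain_decomposition C') :
  exists C'' : {set {set S}},
    [/\ clos_refl_trans _ (legal_merge color) C' C'',
        chain_decomposition C'' & distinct_min_colors color C''].
Proof.
apply: merges_to_distinct_min_colors C'_dec => x y cxy.
have [pC chC] := C_dec.
(* [color_C] only gives the color of an element of a known chain; since the chains cover [S], each
   [z] lies in the chain indexed by its own color. *)
have inC z : z \in C (color z).
  have : z \in cover [set C i | i : 'I_k] by rewrite (cover_partition pC) inE.
  by case/bigcupP => _ /imsetP[i _ ->] zi; rewrite (color_C i z zi).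
by apply: (chC (C (color x))); rewrite ?imset_f // cxy.
Qed.
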